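(* Let $\{(x_i,y_i,d_i): i=1,\dots,N\}$ be a set of strictly convex data, with $x_1<\dots<x_N$, and assume that the derivative parameters satisfy $$d_1<\Delta_1<d_2<\Delta_2<\dots<d_n<\Delta_n<d_{n+1}<\dots<\Delta_{N-1}<d_N .$$ Let $g$ be the corresponding rational cubic spline fractal interpolation function (RCSFIF) with scaling factors $\alpha_n$ and shape parameters $u_n>0$, $v_n>0$ ($n=1,\dots,N-1$). Suppose that for every $n=1,\dots,N-1$ $$0\le\alpha_n<\min\left\{a_n^2,\ \frac{h_n(\Delta_n-d_n)}{y_N-y_1-d_1(x_N-x_1)},\ \frac{h_n(d_{n+1}-\Delta_n)}{d_N(x_N-x_1)-(y_N-y_1)}\right\}$$ and $$v_n\ge\max\left\{u_n\frac{d_{n+1}-\frac{\alpha_n}{h_n}d_N(x_N-x_1)-\big[\Delta_n-\frac{\alpha_n}{h_n}(y_N-y_1)\big]}{\Delta_n-\frac{\alpha_n}{h_n}(y_N-y_1)-\big[d_n-\frac{\alpha_n}{h_n}d_1(x_N-x_1)\big]},\ u_n\frac{\Delta_n-\frac{\alpha_n}{h_n}(y_N-y_1)-\big[d_n-\frac{\alpha_n}{h_n}d_1(x_N-x_1)\big]}{d_{n+1}-\frac{\alpha_n}{h_n}d_N(x_N-x_1)-\big[\Delta_n-\frac{\alpha_n}{h_n}(y_N-y_1)\big]}\right\}.$$ Then $g$ is convex on $I=[x_1,x_N]$.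
   Context: Let $N>2$, $x_1<x_2<\dots<x_N$, $I=[x_1,x_N]$, $I_n=[x_n,x_{n+1}]$, $h_n=x_{n+1}-x_n$, $a_n=h_n/(x_N-x_1)$, $\Delta_n=(y_{n+1}-y_n)/h_n$, and let $L_n:I\to I_n$ be the increasing affine map $L_n(x)=a_nx+b_n$ with $L_n(x_1)=x_n$, $L_n(x_N)=x_{n+1}$ ($n=1,\dots,N-1$). The data are strictly convex if $\Delta_1<\Delta_2<\dots<\Delta_{N-1}$. Given Hermite data $\{(x_i,y_i,d_i)\}_{i=1}^N\subset\mathbb{R}^3$, scaling factors $\alpha_n$ with $|\alpha_n|\le\kappa a_n$ for some $\kappa\in[0,1)$, and shape parameters $u_n>0$, $v_n>0$, the RCSFIF $g$ is the unique continuous function $g:I\to\mathbb{R}$ satisfying $$g(L_n(x))=\alpha_ng(x)+\frac{P_n(\theta)}{Q_n(\theta)},\qquad \theta=\frac{x-x_1}{x_N-x_1},\quad x\in I,\ n=1,\dots,N-1,$$ where $Q_n(\theta)=u_n+v_n\theta(1-\theta)$ and $$\begin{aligned}P_n(\theta)={}&u_n(y_n-\alpha_ny_1)(1-\theta)^3\\&+\{(3u_n+v_n)(y_n-\alpha_ny_1)+u_nh_nd_n-\alpha_nu_n(x_N-x_1)d_1\}(1-\theta)^2\theta\\&+\{(3u_n+v_n)(y_{n+1}-\alpha_ny_N)-u_nh_nd_{n+1}+\alpha_nu_n(x_N-x_1)d_N\}(1-\theta)\theta^2\\&+u_n(y_{n+1}-\alpha_ny_N)\theta^3 .\end{aligned}$$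 It belongs to $\mathcal{C}^1(I)$ and satisfies $g(x_i)=y_i$, $g^{(1)}(x_i)=d_i$ for all $i$. *)

(* Defs.v *)
From HB Require Import structures.
From mathcomp Require Import all_boot all_order all_algebra.
From mathcomp Require Import all_classical all_reals all_analysis.
Set Implicit Arguments.
Unset Strict Implicit.
Unset Printing Implicit Defensive.
Import Order.TTheory GRing.Theory Num.Theory.
Import numFieldNormedType.Exports.
Local Open Scope classical_set_scope.
Local Open Scope ring_scope.

(* The data are sequences [nat -> R] read only at the indices 1, ..., N (knots
   x, ordinates y, derivative values d) or 1, ..., N-1 (scaling factors alpha,
   shape parameters u and v); values at other indices are irrelevant. *)
Section Rcsfif.
Context {R : realType}.
Implicit Types (N n : nat) (x y d alpha u v : nat -> R) (t theta : R).

Definition increasing_knots N x : Prop :=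
  forall n, (0 < n < N)%N -> x n < x n.+1.

Definition knot_step x n : R := x n.+1 - x n.

Definition divdiff x y n : R := (y n.+1 - y n) / knot_step x n.

Definition strictly_convex_data N x y : Prop :=
  forall n, (0 < n)%N -> (n.+1 < N)%N -> divdiff x y n < divdiff x y n.+1.

Definition contr_ratio N x n : R := knot_step x n / (x N - x 1%N).

(* The intercept is fixed by L_n(x_1) = x_n; see [node_map_first] and
   [node_map_last]. *)
Definition node_map N x n t : R :=
  contr_ratio N x n * t + (x n - contr_ratio N x n * x 1%N).

Definition admissible_scaling N x alpha : Prop :=
  exists2 kappa : R, 0 <= kappa < 1 &
    forall n, (0 < n < N)%N -> `|alpha n| <= kappa * contr_ratio N x n.

Definition rcsfif_den u v n theta : R := u n + v n * theta * (1 - theta).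

Definition rcsfif_num N x y d alpha u v n theta : R :=
  u n * (y n - alpha n * y 1%N) * (1 - theta) ^+ 3
  + ((3 * u n + v n) * (y n - alpha n * y 1%N)
     + u n * knot_step x n * d n
     - alpha n * u n * (x N - x 1%N) * d 1%N) * (1 - theta) ^+ 2 * theta
  + ((3 * u n + v n) * (y n.+1 - alpha n * y N)
     - u n * knot_step x n * d n.+1
     + alpha n * u n * (x N - x 1%N) * d N) * (1 - theta) * theta ^+ 2
  + u n * (y n.+1 - alpha n * y N) * theta ^+ 3.

(* [g] is total on R, but only its restriction to [x_1, x_N] is constrained;
   for admissible scaling factors and positive shape parameters that
   restriction is unique. *)
Definition is_rcsfif N x y d alpha u v (g : R -> R) : Prop :=
  {within `[x 1%N, x N], continuous g} /\
  forall n t, (0 < n < N)%N -> t \in `[x 1%N, x N] ->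
    let theta := (t - x 1%N) / (x N - x 1%N) in
    g (node_map N x n t) =
      alpha n * g t
      + rcsfif_num N x y d alpha u v n theta / rcsfif_den u v n theta.

(* Chord slope and end derivatives on I_n of the data reduced by the
   contribution of alpha_n g. *)
Definition reduced_slope N x y alpha n : R :=
  divdiff x y n - alpha n / knot_step x n * (y N - y 1%N).

Definition reduced_dleft N x d alpha n : R :=
  d n - alpha n / knot_step x n * d 1%N * (x N - x 1%N).

Definition reduced_dright N x d alpha n : R :=
  d n.+1 - alpha n / knot_step x n * d N * (x N - x 1%N).

Lemma knots_lt N x : (1 < N)%N -> increasing_knots N x -> x 1%N < x N.
Proof.
elim: N => // -[|[|N]] // IH _ h; first exact: h.
apply: lt_trans (h N.+2 _); last by rewrite /= ltnSn.
by apply: IH => // n /andP[n0 nN]; apply: h; rewrite n0 ltnW.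
Qed.

Lemma node_map_first N x n : node_map N x n (x 1%N) = x n.
Proof. by rewrite /node_map addrC subrK. Qed.

Lemma node_map_last N x n :
  (1 < N)%N -> increasing_knots N x -> node_map N x n (x N) = x n.+1.
Proof.
move=> N1 /(knots_lt N1) lt1N.
rewrite /node_map addrCA -mulrBr /contr_ratio mulfVK ?subr_eq0 ?gt_eqF//.
by rewrite /knot_step addrC subrK.
Qed.

End Rcsfif.

(* Main.v *)
(* Every rational piece is convex and lies above its end tangents, because its
   tangent defect has nonnegative Bernstein coefficients under the shape
   condition. Since 0 <= alpha_n <= kappa < 1, the self-referential equation
   multiplies each defect of g by at most kappa, so a bounded defect vanishes.
   Applied to the excess of the tangent lines at x_1 and x_N over g, this yields
   a support line of g at every knot; applied to the excess of g over its chords,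
   it yields convexity. The support lines make the second step
   local: a chord of g over [s, t] lies above g at the knots in between, hence it
   can be compared with g on a single I_n. *)
Require Import Defs.
From mathcomp Require Import all_boot all_order all_algebra ring lra.
From mathcomp Require Import all_classical all_reals all_analysis.
Import Order.TTheory GRing.Theory Num.Theory.
Import numFieldNormedType.Exports.
Local Open Scope classical_set_scope.
Local Open Scope ring_scope.

(** * Support lines of a rational cubic on the unit interval *)

Section RationalCubic.
Context {R : realFieldType}.
Variables (u v : R).
Hypotheses (u0 : 0 < u) (v0 : 0 < v).
Implicit Types (A B s t : R).

Definition quad_den t : R := u + v * t * (1 - t).

(** The rational cubic with values [Y0], [Y1] and derivatives [D0], [D1] at 0 and 1. *)
Definition hermite_ratio Y0 Y1 D0 D1 t : R :=
  (u * Y0 * (1 - t) ^+ 3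
   + ((3 * u + v) * Y0 + u * D0) * (1 - t) ^+ 2 * t
   + ((3 * u + v) * Y1 - u * D1) * (1 - t) * t ^+ 2
   + u * Y1 * t ^+ 3) / quad_den t.

Lemma quad_den_gt0 t : 0 <= t <= 1 -> 0 < quad_den t.
Proof.
move=> /andP[t0 t1]; rewrite /quad_den ltr_wpDr// mulr_ge0//; last by lra.
by rewrite mulr_ge0// ltW.
Qed.

(* The tangent defect of the quotient is [(t - s) ^+ 2] times a polynomial that
   is affine in [t]; at [t = 0] and [t = 1] the Bernstein coefficients of that
   polynomial in [s] are nonnegative. *)
Lemma linear_over_quad_tangent A B s :
    0 < A -> 0 < B -> u * B <= v * A -> u * A <= v * B -> 0 <= s <= 1 ->
  exists m : R, forall t : R, 0 <= t <= 1 ->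
    (A * (1 - s) + B * s) / quad_den s + m * (t - s)
      <= (A * (1 - t) + B * t) / quad_den t.
Proof.
move=> A0 B0 uBvA uAvB s01; have Qs := quad_den_gt0 _ s01.
pose l x := A * (1 - x) + B * x.
(* This slope is the derivative of the quotient at [s]. *)
exists (((B - A) * quad_den s - l s * (v * (1 - 2 * s))) / quad_den s ^+ 2).
move=> t t01; have Qt := quad_den_gt0 _ t01.
rewrite -/(l s) -/(l t).
pose K x :=
  l s * quad_den s + (l s * v * (1 - 2 * s) - (B - A) * quad_den s) * (1 - s - x).
rewrite -subr_ge0.
have -> : l t / quad_den t - (l s / quad_den s +
   ((B - A) * quad_den s - l s * (v * (1 - 2 * s))) / quad_den s ^+ 2 * (t - s))
   = v * (t - s) ^+ 2 * ((1 - t) * K 0 + t * K 1)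
     / (quad_den t * quad_den s ^+ 2).
  move: (lt0r_neq0 Qs) (lt0r_neq0 Qt); rewrite /K /l /quad_den => nQs nQt.
  by field; rewrite nQs nQt.
have [s0 s1] := andP s01; have [t0 t1] := andP t01.
have s'0 : 0 <= 1 - s by lra.
have K0 : 0 <= K 0.
  have -> : K 0 = (A * (2 * u + v) - B * u) * (1 - s) ^+ 3
     + (A * (4 * u + v) - B * u) * ((1 - s) ^+ 2 * s)
     + u * (2 * A + B) * ((1 - s) * s ^+ 2) + u * B * s ^+ 3.
    by rewrite /K /l /quad_den; ring.
  have uA : 0 < u * A by rewrite mulr_gt0.
  have uB : 0 < u * B by rewrite mulr_gt0.
  by rewrite !addr_ge0// mulr_ge0 ?exprn_ge0 ?mulr_ge0 ?exprn_ge0 ?(ltW u0)//; lra.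
have K1 : 0 <= K 1.
  have -> : K 1 = (B * (2 * u + v) - A * u) * s ^+ 3
     + (B * (4 * u + v) - A * u) * (s ^+ 2 * (1 - s))
     + u * (2 * B + A) * (s * (1 - s) ^+ 2) + u * A * (1 - s) ^+ 3.
    by rewrite /K /l /quad_den; ring.
  have uA : 0 < u * A by rewrite mulr_gt0.
  have uB : 0 < u * B by rewrite mulr_gt0.
  by rewrite !addr_ge0// mulr_ge0 ?exprn_ge0 ?mulr_ge0 ?exprn_ge0 ?(ltW u0)//; lra.
rewrite divr_ge0//.
  rewrite mulr_ge0//; first by rewrite mulr_ge0 ?sqr_ge0// ltW.
  by rewrite addr_ge0// mulr_ge0//; lra.
by rewrite mulr_ge0 ?exprn_ge0// ltW.
Qed.

Section ShapeCondition.
Variables (Y0 Y1 D0 D1 : R).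
Let A := Y1 - Y0 - D0.
Let B := D1 - (Y1 - Y0).
Hypotheses (A0 : 0 < A) (B0 : 0 < B).
Hypotheses (uBvA : u * B <= v * A) (uAvB : u * A <= v * B).
Let r := hermite_ratio Y0 Y1 D0 D1.

(** Division by [quad_den] splits [r] into an affine function plus [u ^+ 2 / v] times a
    linear-over-quadratic quotient. The factor is nonnegative, so support lines of the quotient
    yield support lines of [r]. *)
Lemma hermite_ratio_tangent s : 0 <= s <= 1 ->
  exists m : R, forall t : R, 0 <= t <= 1 -> r s + m * (t - s) <= r t.
Proof.
move=> s01; have [m psi] := linear_over_quad_tangent _ _ _ A0 B0 uBvA uAvB s01.
have rE t : 0 <= t <= 1 -> r t = Y0 + (Y1 - Y0) * t
    - u / v * (A * (1 - t) + B * t)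
    + u ^+ 2 / v * ((A * (1 - t) + B * t) / quad_den t).
  move=> /quad_den_gt0 /lt0r_neq0; rewrite /r /hermite_ratio /A /B /quad_den.
  by move=> Qt; field; rewrite Qt lt0r_neq0.
exists (Y1 - Y0 - u / v * (B - A) + u ^+ 2 / v * m) => t t01.
have c0 : 0 <= u ^+ 2 / v by rewrite divr_ge0 ?sqr_ge0// ltW.
rewrite !rE//; have := ler_wpM2l c0 (psi t t01); lra.
Qed.

(** The tangent at 0 has contact of order two, so [t ^+ 2] factors out of the difference; the shape
    condition makes the cofactor nonnegative. *)
Lemma hermite_ratio_ge_left t : 0 <= t <= 1 -> Y0 + D0 * t <= r t.
Proof.
move=> t01; have Qt := quad_den_gt0 _ t01; have [t0 t1] := andP t01.
rewrite -subr_ge0.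
have -> : r t - (Y0 + D0 * t) =
    t ^+ 2 * (A * u * (2 - t) + (1 - t) * (v * A - u * B)) / quad_den t.
  move: (lt0r_neq0 Qt); rewrite /r /hermite_ratio /A /B /quad_den => nQt.
  by field.
rewrite divr_ge0 ?(ltW Qt)// mulr_ge0 ?sqr_ge0// addr_ge0//
  mulr_ge0 ?mulr_ge0 ?(ltW u0) ?(ltW A0) ?(ltW B0) ?subr_ge0//; lra.
Qed.

Lemma hermite_ratio_ge_right t : 0 <= t <= 1 -> Y1 + D1 * (t - 1) <= r t.
Proof.
move=> t01; have Qt := quad_den_gt0 _ t01; have [t0 t1] := andP t01.
rewrite -subr_ge0.
have -> : r t - (Y1 + D1 * (t - 1)) =
    (1 - t) ^+ 2 * (B * u * (1 + t) + t * (v * B - u * A)) / quad_den t.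
  move: (lt0r_neq0 Qt); rewrite /r /hermite_ratio /A /B /quad_den => nQt.
  by field.
rewrite divr_ge0 ?(ltW Qt)// mulr_ge0 ?sqr_ge0// addr_ge0//
  mulr_ge0 ?mulr_ge0 ?(ltW u0) ?(ltW A0) ?(ltW B0) ?subr_ge0//; lra.
Qed.

End ShapeCondition.

Lemma hermite_ratio0 Y0 Y1 D0 D1 : hermite_ratio Y0 Y1 D0 D1 0 = Y0.
Proof. by rewrite /hermite_ratio /quad_den; field; rewrite lt0r_neq0. Qed.

Lemma hermite_ratio1 Y0 Y1 D0 D1 : hermite_ratio Y0 Y1 D0 D1 1 = Y1.
Proof. by rewrite /hermite_ratio /quad_den; field; rewrite lt0r_neq0. Qed.

End RationalCubic.

(** * Elimination of a defect by contraction *)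

(** Iterating the step makes every [k ^+ j * M] an admissible defect, and these tend to 0. *)
Lemma contracting_bound {R : realType} (P : R -> Prop) (k M : R) :
    0 <= k < 1 -> 0 <= M -> P M -> (forall e, 0 <= e -> P e -> P (k * e)) ->
  forall a b, (forall e, P e -> a <= b + e) -> a <= b.
Proof.
move=> /andP[k0 k1] M0 PM step a b Pab.
have Pk j : P (k ^+ j * M).
  elim: j => [|j IH]; first by rewrite mul1r.
  by rewrite exprS -mulrA; apply: step => //; rewrite mulr_ge0 ?exprn_ge0.
have lim : (fun j => b + k ^+ j * M) @ \oo --> b + 0 * M.
  apply: cvgD; first exact: cvg_cst.
  by apply: cvgMr_tmp; apply: cvg_expr; rewrite ger0_norm.
rewrite mul0r addr0 in lim.
apply: (cvgr_to_ge lim); near=> j; exact: Pab.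
Unshelve. all: end_near. Qed.

(** * Order of the knots and covering by the knot intervals *)

Lemma increasing_knots_le {R : realType} {N : nat} {x : nat -> R} :
  increasing_knots N x ->
  forall i j, (0 < i <= j)%N -> (j <= N)%N -> x i <= x j.
Proof.
move=> hx i j /andP[i0 /subnKC <-]; elim: (j - i)%N => [|k IH].
  by rewrite addn0.
rewrite addnS => ikN; apply: le_trans (IH (ltnW ikN)) _.
by apply/ltW/hx; rewrite addn_gt0 i0.
Qed.

Lemma knot_step_gt0 {R : realType} {N : nat} {x : nat -> R} n :
  increasing_knots N x -> (0 < n < N)%N -> 0 < knot_step x n.
Proof. by move=> hx /hx; rewrite subr_gt0. Qed.

Lemma knot_interval_cover {R : realType} {N : nat} {x : nat -> R} {z : R} :
    (1 < N)%N -> x 1%N <= z <= x N ->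
  exists2 n, (0 < n < N)%N & x n <= z <= x n.+1.
Proof.
elim: N => // -[|N] // IH _ /andP[x1z zN].
case: (leP z (x N.+1)) => [zle|/ltW zge]; last by exists N.+1; rewrite ?ltnSn ?zge.
case: N => [|N] in IH zN zle *.
  by exists 1%N; rewrite // x1z zN.
have [n /andP[n0 nN] zn] := IH isT (introT andP (conj x1z zle)).
by exists n; rewrite // n0 ltnW.
Qed.

(** * Comparison of the Hermite tangent lines *)

Section TangentLines.
Context {R : realType} {N : nat} {x y d : nat -> R}.
Hypothesis hx : increasing_knots N x.
Hypothesis hd : forall n, (0 < n < N)%N -> d n < divdiff x y n < d n.+1.

Definition knot_line n z : R := y n + d n * (z - x n).

Let step_bounds n : (0 < n < N)%N ->
  [/\ y n + d n * knot_step x n <= y n.+1,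
      y n.+1 <= y n + d n.+1 * knot_step x n & d n <= d n.+1].
Proof.
move=> n0N; have h0 := knot_step_gt0 _ hx n0N.
have /andP[] := hd _ n0N; rewrite /divdiff ltr_pdivlMr// ltr_pdivrMr// => l1 l2.
split; [lra | lra |].
by have /andP[l3 /(lt_trans l3)/ltW] := hd _ n0N.
Qed.

(** Since [d n < divdiff x y n < d n.+1], the lines at consecutive knots cross between these knots,
    and beyond the crossing the later line is the higher one. *)
Lemma knot_line_le_right i j z :
  (0 < i <= j)%N -> (j <= N)%N -> x j <= z -> knot_line i z <= knot_line j z.
Proof.
move=> /andP[i0 /subnKC <-]; elim: (j - i)%N => [|k IH].
  by rewrite addn0.
rewrite addnS; set n := (i + k)%N => nN xz.
have n0N : (0 < n < N)%N by rewrite addn_gt0 i0.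
have [l1 l2 l3] := step_bounds _ n0N.
have xn := ltW (hx _ n0N).
apply: le_trans (IH (ltnW nN) (le_trans xn xz)) _; rewrite /knot_line.
have : 0 <= (d n.+1 - d n) * (z - x n.+1) by rewrite mulr_ge0 ?subr_ge0.
rewrite /knot_step in l1; lra.
Qed.

Lemma knot_line_le_left i j z :
  (0 < i <= j)%N -> (j <= N)%N -> z <= x i -> knot_line j z <= knot_line i z.
Proof.
move=> /andP[i0 /subnKC <-]; elim: (j - i)%N => [|k IH].
  by rewrite addn0.
rewrite addnS; set n := (i + k)%N => nN zx.
have n0N : (0 < n < N)%N by rewrite addn_gt0 i0.
have [l1 l2 l3] := step_bounds _ n0N.
apply: le_trans (IH (ltnW nN) zx); rewrite /knot_line.
have xin : x i <= x n.
  by apply: (increasing_knots_le hx); rewrite ?i0 ?leq_addr// ltnW.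
have : 0 <= (d n.+1 - d n) * (x n - z).
  by rewrite mulr_ge0 ?subr_ge0// (le_trans zx).
rewrite /knot_step in l2; lra.
Qed.

End TangentLines.
Arguments knot_line {R} x y d n z.

(** * Support lines and convexity of a self-referential interpolant *)

Section ConvexFractalInterpolant.
Context {R : realType} {N : nat} {x y d alpha : nat -> R} {r : nat -> R -> R}.
Context {g : R -> R} {k M : R}.
Let I z := x 1%N <= z <= x N.
Let L := x N - x 1%N.
Let h n := knot_step x n.
Hypothesis N1 : (1 < N)%N.
Hypothesis hx : increasing_knots N x.
Hypothesis hd : forall n, (0 < n < N)%N -> d n < divdiff x y n < d n.+1.
Hypothesis k01 : 0 <= k < 1.
Hypothesis gM : forall z, I z -> `|g z| <= M.
Hypothesis alpha_bounds : forall n, (0 < n < N)%N -> 0 <= alpha n <= k.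
Hypothesis gE : forall n (s : R), (0 < n < N)%N -> 0 <= s <= 1 ->
  g (x n + h n * s) = alpha n * g (x 1%N + L * s) + r n s.
Hypothesis r0 : forall n, (0 < n < N)%N -> r n 0 = y n - alpha n * y 1%N.
Hypothesis r1 : forall n, (0 < n < N)%N -> r n 1 = y n.+1 - alpha n * y N.
Hypothesis r_left : forall n (s : R), (0 < n < N)%N -> 0 <= s <= 1 ->
  y n - alpha n * y 1%N + (h n * d n - alpha n * L * d 1%N) * s <= r n s.
Hypothesis r_right : forall n (s : R), (0 < n < N)%N -> 0 <= s <= 1 ->
  y n.+1 - alpha n * y N + (h n * d n.+1 - alpha n * L * d N) * (s - 1) <= r n s.
Hypothesis r_tangent : forall n (s : R), (0 < n < N)%N -> 0 <= s <= 1 ->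
  exists m : R, forall t : R, 0 <= t <= 1 -> r n s + m * (t - s) <= r n t.

Let x1N : x 1%N < x N. Proof. exact: knots_lt. Qed.
Let L0 : 0 < L. Proof. by rewrite subr_gt0. Qed.
Let h0 n : (0 < n < N)%N -> 0 < h n. Proof. exact: knot_step_gt0. Qed.

Let M0 : 0 <= M.
Proof. by apply: le_trans (gM (x 1%N) _) => //; rewrite /I lexx ltW. Qed.

Let I_affine (s : R) : 0 <= s <= 1 -> I (x 1%N + L * s).
Proof.
move=> /andP[s0 s1]; rewrite /I; have := mulr_ge0 (ltW L0) s0.
by have := ler_wpM2l (ltW L0) s1; rewrite /L; lra.
Qed.

Let local_coord n z : (0 < n < N)%N -> x n <= z <= x n.+1 ->
  exists2 s : R, 0 <= s <= 1 & z = x n + h n * s.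
Proof.
move=> n0N /andP[xz zx]; have hn := h0 _ n0N.
exists ((z - x n) / h n); last by rewrite mulrC divfK ?gt_eqF// addrC subrK.
apply/andP; split; first by rewrite divr_ge0 ?(ltW hn)// subr_ge0.
by rewrite ler_pdivrMr// mul1r /h /knot_step lerD2r.
Qed.

(** The first node map fixes [x 1%N], so the equation there determines [g (x 1%N)] because
    [alpha 1%N <= k < 1]. *)
Let g_first : g (x 1%N) = y 1%N.
Proof.
have n0N : (0 < 1 < N)%N by [].
have /andP[a0 ak] := alpha_bounds _ n0N.
have := gE _ 0 n0N; rewrite lexx ler01 !mulr0 !addr0 r0// => /(_ isT) e.
have : (1 - alpha 1%N) * (g (x 1%N) - y 1%N) = 0 by lra.
have : 1 - alpha 1%N != 0 by case/andP: k01 => _ k1; lra.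
by move=> /negbTE nz /eqP; rewrite mulf_eq0 nz subr_eq0 => /eqP.
Qed.

Let g_last : g (x N) = y N.
Proof.
have n0N : (0 < N.-1 < N)%N by case: N N1 => [|[|n]] //= _; rewrite ltnSn.
have NE : N.-1.+1 = N by rewrite prednK// ltnW.
have /andP[a0 ak] := alpha_bounds _ n0N.
have := gE _ 1 n0N; rewrite lexx ler01 !mulr1 r1// /h /L /knot_step NE.
rewrite ![_ + (x N - _)]addrC !subrK => {NE} /(_ isT) e.
have : (1 - alpha N.-1) * (g (x N) - y N) = 0 by lra.
have : 1 - alpha N.-1 != 0 by case/andP: k01 => _ k1; lra.
by move=> /negbTE nz /eqP; rewrite mulf_eq0 nz subr_eq0 => /eqP.
Qed.

Let g_knot i : (0 < i <= N)%N -> g (x i) = y i.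
Proof.
move=> /andP[i0]; rewrite leq_eqVlt => /predU1P[->//|iN].
have := gE i 0; rewrite i0 iN lexx ler01 !mulr0 !addr0 r0 ?i0// g_first.
by move=> /(_ isT isT) ->; lra.
Qed.

Let line_defect i e := forall z, I z -> knot_line x y d i z <= g z + e.

(** Supplies the starting defect for the contraction. *)
Let line_bounded i : exists2 B, 0 <= B & line_defect i B.
Proof.
pose c := `|y i| + `|d i| * (`|x 1%N| + `|x N| + `|x i|).
exists (c + M) => [|z Iz]; first by rewrite !addr_ge0 ?mulr_ge0 ?addr_ge0.
have lc : knot_line x y d i z <= c.
  apply: le_trans (ler_norm _) _; apply: le_trans (ler_normD _ _) _.
  rewrite lerD2l normrM ler_wpM2l//; apply: le_trans (ler_normB _ _) _.
  rewrite lerD2r; move: Iz => /andP[z1 z2].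
  have := ler_norm (x N); have := ler_norm (- x 1%N); rewrite normrN.
  have := normr_ge0 (x N); have := normr_ge0 (x 1%N).
  by move=> *; rewrite ler_norml; apply/andP; split; lra.
have := gM _ Iz; rewrite ler_norml => /andP[? ?]; lra.
Qed.

(** On the n-th interval the first line lies below the line at knot [n], which is [alpha n] times
    the first line at the preimage plus the left end tangent of [r n]. The defect is thus multiplied
    by [alpha n <= k]. *)
Let first_line_below z : I z -> knot_line x y d 1 z <= g z.
Proof.
have [B B0 PB] := line_bounded 1 => Iz.
apply: (contracting_bound (line_defect 1) k B k01 B0 PB) => [e e0 He w Iw|e]; last first.
  exact.
have [n n0N wn] := knot_interval_cover N1 Iw.
have [s s01 wE] := local_coord _ _ n0N wn.
have /andP[n0 nN] := n0N.
apply: le_trans (knot_line_le_right hx hd 1 n w _ (ltnW nN) _) _.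
- by rewrite n0.
- by case/andP: wn.
have /andP[a0 ak] := alpha_bounds _ n0N.
rewrite wE gE//; have := r_left _ _ n0N s01.
have := ler_wpM2l a0 (He _ (I_affine _ s01)); have := ler_wpM2r e0 ak.
by rewrite /knot_line; lra.
Qed.

Let last_line_below z : I z -> knot_line x y d N z <= g z.
Proof.
have [B B0 PB] := line_bounded N => Iz.
apply: (contracting_bound (line_defect N) k B k01 B0 PB) => [e e0 He w Iw|e]; last first.
  exact.
have [n n0N wn] := knot_interval_cover N1 Iw.
have [s s01 wE] := local_coord _ _ n0N wn.
have /andP[n0 nN] := n0N.
apply: le_trans (knot_line_le_left hx hd n.+1 N w _ (leqnn _) _) _.
- by rewrite nN.
- by case/andP: wn.
have /andP[a0 ak] := alpha_bounds _ n0N.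
have -> : knot_line x y d n.+1 w = y n.+1 + d n.+1 * (h n * (s - 1)).
  by rewrite /knot_line wE /h /knot_step; ring.
rewrite wE gE//; have := r_right _ _ n0N s01.
have := ler_wpM2l a0 (He _ (I_affine _ s01)); have := ler_wpM2r e0 ak.
by rewrite /knot_line /L; lra.
Qed.

(** The same splitting is applied once, without iteration, since the two end lines are already known
    to lie below [g]. *)
Let knot_line_below i z : (0 < i <= N)%N -> I z -> knot_line x y d i z <= g z.
Proof.
move=> /andP[i0 iN] Iz.
have [n n0N zn] := knot_interval_cover N1 Iz.
have [s s01 zE] := local_coord _ _ n0N zn.
have /andP[n0 nN] := n0N; have /andP[xnz zxn] := zn.
have /andP[a0 ak] := alpha_bounds _ n0N.
(* The line at knot [i] is dominated at [z] by the line at the end of the n-th interval on the side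
   of [x i]. *)
case: (leqP i n) => [le_in|lt_ni].
  apply: le_trans (knot_line_le_right hx hd i n z _ (ltnW nN) xnz) _.
    by rewrite i0.
  rewrite zE gE//; have := r_left _ _ n0N s01.
  have := ler_wpM2l a0 (first_line_below _ (I_affine _ s01)).
  by rewrite /knot_line; lra.
apply: le_trans (knot_line_le_left hx hd n.+1 i z _ iN zxn) _ => //.
have -> : knot_line x y d n.+1 z = y n.+1 + d n.+1 * (h n * (s - 1)).
  by rewrite /knot_line zE /h /knot_step; ring.
rewrite zE gE//; have := r_right _ _ n0N s01.
have := ler_wpM2l a0 (last_line_below _ (I_affine _ s01)).
by rewrite /knot_line /L; lra.
Qed.

(** Any affine function above [g] at both ends replaces the chord: this class survives subtracting a
    tangent and rescaling, and it needs no division by [t - s]. *)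
Let chord_defect e := forall m c s p t : R, I s -> I t -> s <= p <= t ->
  g s <= m * s + c -> g t <= m * t + c -> g p <= m * p + c + e.

Let affine_between (m c a s p t : R) : s <= p <= t ->
  a <= m * s + c -> a <= m * t + c -> a <= m * p + c.
Proof.
move=> /andP[sp pt] as_ at_; case: (leP 0 m) => m0.
  by have := ler_wpM2l m0 sp; lra.
by have := ler_wnM2l (ltW m0) pt; lra.
Qed.

(** The affine function is at least [- M] at [s] and [t], hence at [p], while [g p <= M]. *)
Let chord_bounded : chord_defect (M + M).
Proof.
move=> m c s p t Is It /andP[sp pt] gs gt.
have Ip : I p.
  case/andP: Is => s1 _; case/andP: It => _ t2.
  by rewrite /I (le_trans s1 sp) (le_trans pt t2).
have := gM _ Ip; have := gM _ Is; have := gM _ It.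
rewrite !ler_norml => /andP[t1 t2] /andP[s1 s2] /andP[p1 p2].
have : - M <= m * p + c by apply: (affine_between _ _ _ s _ t); lra.
by lra.
Qed.

(** The support line at [x i] is below [g], hence below the affine function at [s] and [t], hence
    also in between; at [x i] it takes the value [y i]. *)
Let knot_below_chord i m c s t : (0 < i <= N)%N -> I s -> I t ->
    s <= x i <= t -> g s <= m * s + c -> g t <= m * t + c ->
  g (x i) <= m * x i + c.
Proof.
move=> i0N Is It sit gs gt; rewrite g_knot//.
have ls := knot_line_below _ _ i0N Is; have lt := knot_line_below _ _ i0N It.
rewrite /knot_line in ls lt.
suff : y i <= (m - d i) * x i + (c + d i * x i) by lra.
by apply: affine_between sit _ _; lra.
Qed.

(** On one knot interval, the tangent of [r n] at [q] is subtracted from the chord. The rest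
    dominates the [alpha n * g] term at both ends; divided by [alpha n] and pulled back to [I], it
    has defect [e], which returns as [alpha n * e]. *)
Let chord_step e : 0 <= e -> chord_defect e -> chord_defect (k * e).
Proof.
move=> e0 He m c s p t Is It /andP[sp pt] gs gt.
have Ip : I p.
  case/andP: Is => s1 _; case/andP: It => _ t2.
  by rewrite /I (le_trans s1 sp) (le_trans pt t2).
have [n n0N pn] := knot_interval_cover N1 Ip.
have /andP[n0 nN] := n0N; have /andP[xnp pxn] := pn.
have [q q01 pE] := local_coord _ _ n0N pn.
(* Knots between [s] and [t] lie below the chord because each of them carries a
   support line, so the chord may be cut down to the interval containing [p]. *)
have [a a01 [aq ga]] : exists2 a : R, 0 <= a <= 1 &
    a <= q /\ g (x n + h n * a) <= m * (x n + h n * a) + c.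
  case: (leP (x n) s) => xs.
    have [|a a01 sE] := local_coord n s n0N.
      by rewrite xs (le_trans sp pxn).
    exists a => //; rewrite -sE; split=> //.
    by move: sp; rewrite sE pE lerD2l ler_pM2l ?h0.
  exists 0; first by rewrite lexx ler01.
  split; first by case/andP: q01.
  rewrite mulr0 addr0; apply: (knot_below_chord _ _ _ s t) => //.
    by rewrite n0 ltnW.
  by rewrite (ltW xs) (le_trans xnp pt).
have [b b01 [qb gb]] : exists2 b : R, 0 <= b <= 1 &
    q <= b /\ g (x n + h n * b) <= m * (x n + h n * b) + c.
  case: (leP t (x n.+1)) => tx.
    have [|b b01 tE] := local_coord n t n0N.
      by rewrite tx (le_trans xnp pt).
    exists b => //; rewrite -tE; split=> //.
    by move: pt; rewrite tE pE lerD2l ler_pM2l ?h0.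
  exists 1; first by rewrite lexx ler01.
  split; first by case/andP: q01.
  rewrite mulr1 /h /knot_step addrC subrK.
  apply: (knot_below_chord _ _ _ s t) => //.
  by rewrite (ltW tx) andbT (le_trans sp pxn).
have [mu tan] := r_tangent _ _ n0N q01.
have /andP[al0 alk] := alpha_bounds _ n0N.
have aqb : a <= q <= b by rewrite aq qb.
rewrite pE gE//; rewrite !gE// in ga gb.
have ta := tan _ a01; have tb := tan _ b01.
(* [C] is the chord minus the tangent line of [r n] at [q]. *)
pose C w := (m * h n - mu) * w + (m * x n + c - r n q + mu * q).
have Ca : alpha n * g (x 1%N + L * a) <= C a by rewrite /C; lra.
have Cb : alpha n * g (x 1%N + L * b) <= C b by rewrite /C; lra.
suff Cq : alpha n * g (x 1%N + L * q) <= C q + k * e by rewrite /C in Cq; lra.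
(* For [alpha n = 0] there is nothing to rescale: [C] is nonnegative at [a] and [b], hence at
   [q]. *)
move: al0; rewrite le_eqVlt => /predU1P[al0|al0].
  rewrite -al0 !mul0r in Ca Cb *.
  have ke : 0 <= k * e by rewrite mulr_ge0//; case/andP: k01.
  by rewrite addr_ge0//; apply: affine_between aqb Ca Cb.
(* Coefficients of [C / alpha n] as an affine function of [x 1%N + L * w]. *)
pose m' := (m * h n - mu) / (alpha n * L).
pose c' := (m * x n + c - r n q + mu * q) / alpha n - m' * x 1%N.
have CE w : C w = alpha n * (m' * (x 1%N + L * w) + c').
  by rewrite /C /c' /m'; field; rewrite !gt_eqF.
rewrite !CE !ler_pM2l// in Ca Cb.
have : g (x 1%N + L * q) <= m' * (x 1%N + L * q) + c' + e.
  apply: He Ca Cb; try exact: I_affine.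
  by rewrite !lerD2l !(ler_pM2l L0).
move=> /(ler_wpM2l (ltW al0)); rewrite CE; have := ler_wpM2r e0 alk.
by lra.
Qed.

Lemma fractal_interpolant_convex : convex_function (E := R^o) `[x 1%N, x N] g.
Proof.
have chord m c s p t : I s -> I t -> s <= p <= t ->
    g s <= m * s + c -> g t <= m * t + c -> g p <= m * p + c.
  move=> Is It spt gs gt.
  apply: (contracting_bound chord_defect k (M + M) k01) => //.
    exact: addr_ge0.
  by move=> e He; apply: He gs gt.
(* Ordered endpoints come first, the other order by symmetry; equal endpoints are split off because
   [m] divides by [w - s]. *)
have le_case (t s w : R) : 0 <= t <= 1 -> I s -> I w -> s <= w ->
    g (t * s + (1 - t) * w) <= t * g s + (1 - t) * g w.
  move=> /andP[t0 t1] Is Iw; rewrite le_eqVlt => /predU1P[->|sw].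
    by rewrite -!mulrDl subrKC !mul1r.
  have nsw : w - s != 0 by rewrite subr_eq0 gt_eqF.
  pose m := (g w - g s) / (w - s).
  have mE : m * (w - s) = g w - g s by rewrite divfK.
  have tsw : s <= t * s + (1 - t) * w <= w.
    have := mulr_ge0 t0 (ltW (etrans (subr_gt0 _ _) sw)).
    have : 0 <= (1 - t) * (w - s) by rewrite mulr_ge0 ?subr_ge0// ltW.
    by move=> *; apply/andP; split; lra.
  have := chord m (g s - m * s) s _ w Is Iw tsw.
  move=> /(_ ltac:(lra) ltac:(lra)) /le_trans; apply.
  rewrite (_ : g w = g s + m * (w - s)); last by rewrite mE; ring.
  by rewrite le_eqVlt; apply/orP; left; apply/eqP; ring.
move=> t s w; rewrite !inE /= !in_itv/= => Is Iw.
change (g (t%:num * s + (1 - t%:num) * w) <= t%:num * g s + (1 - t%:num) * g w).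
case: (leP s w) => [|/ltW] sw; first by apply: le_case; rewrite ?ge0 ?le1.
have := le_case (1 - t%:num) w s _ Iw Is sw; rewrite subKr.
rewrite (addrC (_ * w)) (addrC (_ * g w)); apply.
by rewrite subr_ge0 le1 gerBl ge0.
Qed.

End ConvexFractalInterpolant.

(* The denominator [c] is not assumed positive: a nonpositive [c], including the
   junk value [b / 0 = 0], would contradict [0 <= a < b / c]. *)
Lemma mul_lt_of_lt_div {R : realFieldType} {a b c : R} :
  0 <= a -> 0 <= b -> a < b / c -> a * c < b.
Proof.
move=> a0 b0 abc; case: (ltP 0 c) => c0; first by rewrite -ltr_pdivlMr.
have : b / c <= 0 by rewrite mulr_ge0_le0 ?invr_le0.
by move=> /(le_lt_trans a0 \o lt_le_trans abc); rewrite ltxx.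
Qed.

(** * Application to the rational cubic spline *)

Theorem theorem5 (R : realType) (N : nat) (x y d alpha u v : nat -> R)
    (g : R -> R)
  (hN : (2 < N)%N)
  (hx : increasing_knots N x)
  (hy : strictly_convex_data N x y)
  (hd : forall n, (0 < n < N)%N -> d n < divdiff x y n < d n.+1)
  (hkappa : admissible_scaling N x alpha)
  (hu : forall n, (0 < n < N)%N -> 0 < u n)
  (hv : forall n, (0 < n < N)%N -> 0 < v n)
  (hg : is_rcsfif N x y d alpha u v g)
  (halpha : forall n, (0 < n < N)%N ->
     0 <= alpha n
     < Num.min (contr_ratio N x n ^+ 2)
         (Num.min
            (knot_step x n * (divdiff x y n - d n)
             / (y N - y 1%N - d 1%N * (x N - x 1%N)))
            (knot_step x n * (d n.+1 - divdiff x y n)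
             / (d N * (x N - x 1%N) - (y N - y 1%N)))))
  (hshape : forall n, (0 < n < N)%N ->
     Num.max
       (u n * ((reduced_dright N x d alpha n - reduced_slope N x y alpha n)
               / (reduced_slope N x y alpha n - reduced_dleft N x d alpha n)))
       (u n * ((reduced_slope N x y alpha n - reduced_dleft N x d alpha n)
               / (reduced_dright N x d alpha n - reduced_slope N x y alpha n)))
     <= v n) :
  convex_function (E := R^o) `[x 1%N, x N] g.

Proof.
have N1 : (1 < N)%N by apply: ltn_trans hN.
have [k k01 hk] := hkappa; have [gc gE] := hg.
have x1N := knots_lt N1 hx.
set L := x N - x 1%N; pose h n := knot_step x n.
have L0 : 0 < L by rewrite subr_gt0.
have h0 n : (0 < n < N)%N -> 0 < h n by exact: knot_step_gt0.
have [M gM] : exists M, forall z, x 1%N <= z <= x N -> `|g z| <= M.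
  have [c1 _ cmax] := EVT_max (ltW x1N) gc.
  have [c2 _ cmin] := EVT_min (ltW x1N) gc.
  exists (`|g c1| + `|g c2|) => z z1N.
  have zI : z \in `[x 1%N, x N] by rewrite in_itv.
  have := ler_norm (g c1); have := ler_norm (- g c2); rewrite normrN.
  have := cmax _ zI; have := cmin _ zI.
  have := normr_ge0 (g c1); have := normr_ge0 (g c2).
  by move=> *; rewrite ler_norml; apply/andP; split; lra.
(* End values and derivatives of the n-th rational piece in the unit variable, whence the factors
   [h n] and [L] on the slopes. *)
pose Y0 n := y n - alpha n * y 1%N; pose Y1 n := y n.+1 - alpha n * y N.
pose D0 n := h n * d n - alpha n * L * d 1%N.
pose D1 n := h n * d n.+1 - alpha n * L * d N.
pose A n := Y1 n - Y0 n - D0 n; pose B n := D1 n - (Y1 n - Y0 n).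
have hD n : (0 < n < N)%N -> h n * divdiff x y n = y n.+1 - y n.
  by move=> n0N; rewrite mulrC divfK// gt_eqF// h0.
(* Cleared of its denominator, the second bound on [alpha n] is [0 < A n]; the third is
   [0 < B n]. *)
have A0 n : (0 < n < N)%N -> 0 < A n.
  move=> n0N; have /andP[a0] := halpha _ n0N; rewrite !lt_min => /and3P[_ aA _].
  have /andP[dl _] := hd _ n0N.
  have := mul_lt_of_lt_div a0 _ aA.
  rewrite mulr_ge0 ?(ltW (h0 _ n0N)) ?subr_ge0 ?(ltW dl)// => /(_ isT).
  by have := hD _ n0N; rewrite -/(h n) /A /Y0 /Y1 /D0 /L; lra.
have B0 n : (0 < n < N)%N -> 0 < B n.
  move=> n0N; have /andP[a0] := halpha _ n0N; rewrite !lt_min => /and3P[_ _ aB].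
  have /andP[_ dr] := hd _ n0N.
  have := mul_lt_of_lt_div a0 _ aB.
  rewrite mulr_ge0 ?(ltW (h0 _ n0N)) ?subr_ge0 ?(ltW dr)// => /(_ isT).
  by have := hD _ n0N; rewrite -/(h n) /B /Y0 /Y1 /D1 /L; lra.
(* The differences in the bound on [v n] are [A n / h n] and [B n / h n], so [h n] cancels in their
   ratios. *)
have shape n : (0 < n < N)%N -> u n * B n <= v n * A n /\ u n * A n <= v n * B n.
  move=> n0N; have hn := lt0r_neq0 (h0 _ n0N).
  have An := A0 _ n0N; have Bn := B0 _ n0N.
  have AE : reduced_slope N x y alpha n - reduced_dleft N x d alpha n = A n / h n.
    rewrite /reduced_slope /reduced_dleft /divdiff -/(h n) /A /Y0 /Y1 /D0 /L.
    by field.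
  have BE : reduced_dright N x d alpha n - reduced_slope N x y alpha n = B n / h n.
    rewrite /reduced_slope /reduced_dright /divdiff -/(h n) /B /Y0 /Y1 /D1 /L.
    by field.
  have := hshape _ n0N; rewrite AE BE !invf_div !mulf_div.
  rewrite ge_max => /andP[].
  by rewrite ![_ * h n]mulrC -!mulf_div divff// !mul1r !mulrA !ler_pdivrMr//.
pose r n := hermite_ratio (u n) (v n) (Y0 n) (Y1 n) (D0 n) (D1 n).
apply: (@fractal_interpolant_convex R N x y d alpha r g k M) => //.
(* The contraction ratio of a node map is at most 1, so [alpha n <= k]. *)
- move=> n n0N; have /andP[n0 nN] := n0N; have /andP[-> _] /= := halpha _ n0N.
  apply: le_trans (ler_norm _) _; apply: le_trans (hk _ n0N) _.
  have /andP[k0 _] := k01; rewrite ler_piMr// /contr_ratio ler_pdivrMr// mul1r.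
  have := increasing_knots_le hx 1 n; rewrite n0 => /(_ isT (ltnW nN)).
  have := increasing_knots_le hx n.+1 N; rewrite nN => /(_ isT (leqnn _)).
  by rewrite /knot_step; lra.
- move=> n s n0N s01; have [s0 s1] := andP s01; rewrite -/L -/(h n).
  have tI : x 1%N + L * s \in `[x 1%N, x N].
    rewrite in_itv /=; have := mulr_ge0 (ltW L0) s0.
    by have := ler_wpM2l (ltW L0) s1; rewrite /L; lra.
  have sE : (x 1%N + L * s - x 1%N) / L = s.
    by rewrite addrC addKr mulrC mulKf// gt_eqF.
  have tE : node_map N x n (x 1%N + L * s) = x n + h n * s.
    by rewrite /node_map /contr_ratio -/L -/(h n); field; exact: lt0r_neq0.
  have := gE n _ n0N tI; rewrite -/L sE tE => ->.
  rewrite /r /hermite_ratio /quad_den /rcsfif_num /rcsfif_den /Y0 /Y1 /D0 /D1.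
  by rewrite -/L -/(h n); congr (_ + _ / _); ring.
- by move=> n n0N; rewrite /r hermite_ratio0// hu.
- by move=> n n0N; rewrite /r hermite_ratio1// hu.
- move=> n s n0N; have [s1 s2] := shape _ n0N.
  by apply: hermite_ratio_ge_left => //; [exact: hu|exact: hv|exact: A0].
- move=> n s n0N; have [s1 s2] := shape _ n0N.
  by apply: hermite_ratio_ge_right => //; [exact: hu|exact: hv|exact: B0].
- move=> n s n0N; have [s1 s2] := shape _ n0N.
  by apply: hermite_ratio_tangent => //; [exact: hu|exact: hv|exact: A0|exact: B0].
Qed.
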